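(* Let $X$ be a Banach space. If $SG(X)<\mathfrak{p}$, then $X$ has property (K).
   Context: All linear spaces are real. Given a sequence $(x_n)$ in a linear space, a convex block subsequence of $(x_n)$ is a sequence $(y_k)$ of the form $y_k=\sum_{n\in I_k}a_n x_n$, where $(I_k)$ is a sequence of finite subsets of $\mathbb{N}$ with $\max(I_k)<\min(I_{k+1})$ and $(a_n)$ is a sequence of non-negative real numbers with $\sum_{n\in I_k}a_n=1$ for all $k\in\mathbb{N}$. For a Banach space $X$, the Mackey topology $\mu(X^*,X)$ on $X^*$ is the topology of uniform convergence on weakly compact subsets of $X$. A Banach space $X$ has property (K) if every $w^*$-convergent sequence in $X^*$ admits a convex block subsequence which is $\mu(X^*,X)$-convergent. A family $\mathcal{G}$ of weakly compact subsets of a Banach space $X$ strongly generates $X$ if for every weakly compact set $L\subseteq X$ and every $\varepsilon>0$ there is $G\in\mathcal{G}$ such that $L\subseteq G+\varepsilon B_X$, where $B_X$ is the closed unit ball of $X$. $SG(X)$ denotes the least cardinality of a family of weakly compact subsets of $X$ which strongly generates $X$. The cardinal $\mathfrak{p}$ is the least cardinality of a family $\mathcal{M}$ of infinite subsets of $\mathbb{N}$ such that: $\bigcap\mathcal{N}$ is infinite for every finite subfamily $\mathcal{N}\subseteq\mathcal{M}$, and there is no infinite set $A\subseteq\mathbb{N}$ such that $A\setminus M$ is finite for all $M\in\mathcal{M}$. *)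

(* Defs.v *)
From HB Require Import structures.
From mathcomp Require Import all_boot all_order all_algebra finmap.
From mathcomp Require Import all_classical all_reals all_analysis.

Set Implicit Arguments.
Unset Strict Implicit.
Unset Printing Implicit Defensive.

Import Order.TTheory GRing.Theory Num.Theory.
Import numFieldNormedType.Exports.

Local Open Scope classical_set_scope.
Local Open Scope ring_scope.

(** Cardinals are represented by sets, compared with [#<=].  A cardinal defined
    as the least cardinality of a set satisfying [P] is represented by some set
    of least cardinality satisfying [P]; [least_cardP] shows that such a set
    exists as soon as [P] is satisfiable. *)

Definition card_lt T U (A : set T) (B : set U) : Prop :=
  (A #<= B)%card /\ ~ (B #<= A)%card.

Definition has_least_card T (P : set (set T)) (A : set T) : Prop :=
  P A /\ forall B, P B -> (A #<= B)%card.

Definition least_card (T : choiceType) (P : set (set T)) : set T :=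
  get (has_least_card P).

Lemma has_least_card_ex (T : choiceType) (P : set (set T)) :
  P !=set0 -> exists A, has_least_card P A.
Proof.
case=> A0 PA0.
(* a maximal partial transversal of the product of the members of [P], all of
   whose projections are injective, projects onto some member of [P] *)
pose partial (S : set (set T -> T)) :=
  (forall h A, S h -> P A -> A (h A)) /\
  (forall h k A, S h -> S k -> P A -> h A = k A -> h = k).
have [F FP totF|S [[Sin Sinj] Smax]] := @Zorn_bigcup _ partial.
  split=> [h A [S FS Sh]|h k A [S FS Sh] [S' FS' S'k]].
    exact: (proj1 (FP S FS)).
  have [SS'|S'S] := totF _ _ FS FS'.
    by apply: (FP S' FS').2 => //; apply: SS'.
  by apply: (FP S FS).2 => //; apply: S'S.
have [[A PA Asurj]|nsurj] :=
    pselect (exists2 A, P A & forall x, A x -> exists2 h, S h & h A = x).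
  exists A; split=> // B PB; apply: (@card_le_trans _ _ _ S).
    apply: card_le_trans (card_image_le (fun h => h A) S).
    by apply: subset_card_le => x /Asurj[h Sh <-]; exists h.
  have inj : {in S &, injective (fun h : set T -> T => h B)}.
    by move=> h k; rewrite !inE => Sh Sk; apply: Sinj.
  rewrite -(card_le_eql (inj_card_eq inj)); apply: subset_card_le.
  by move=> _ [h Sh <-]; exact: (Sin h B Sh PB).
have fresh A : P A -> exists x, A x /\ forall h, S h -> h A <> x.
  move=> PA; apply: contrapT => H; apply: nsurj; exists A => // x Ax.
  apply: contrapT => H'; apply: H; exists x; split=> // h Sh hA.
  by apply: H'; exists h.
have [x0 _] := fresh _ PA0.
have /choice[h hP] A :
    exists x, P A -> A x /\ forall h, S h -> h A <> x.
  by have [/fresh[x]|nPA] := pselect (P A); [exists x|exists x0].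
exfalso; apply: (Smax (S `|` [set h])).
  split=> [|/(_ h (or_intror erefl)) Sh]; first exact: subsetUl.
  by have [_ /(_ h Sh)] := hP _ PA0.
split=> [k A [Sk|->] PA|k l A [Sk|->] [Sl|->] PA //].
- exact: (Sin k A Sk PA).
- exact: (hP _ PA).1.
- exact: Sinj Sk Sl PA.
- by move=> e; have [_ /(_ k Sk)] := hP _ PA.
- by move=> e; have [_ /(_ l Sl)] := hP _ PA; rewrite e.
Qed.

Lemma least_cardP (T : choiceType) (P : set (set T)) :
  P !=set0 -> has_least_card P (least_card P).
Proof. by move=> /has_least_card_ex/getPex. Qed.

(** The cardinal p, represented by a family of least cardinality. *)

Definition strong_fip (M : set (set nat)) : Prop :=
  forall N : set (set nat), N `<=` M -> finite_set N ->
    infinite_set (\bigcap_(A in N) A).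

Definition has_pseudo_intersection (M : set (set nat)) : Prop :=
  exists A : set nat, infinite_set A /\ forall B, M B -> finite_set (A `\` B).

Definition p_family (M : set (set nat)) : Prop :=
  [/\ forall A, M A -> infinite_set A, strong_fip M
    & ~ has_pseudo_intersection M].

Definition pseudo_intersection_number : set (set nat) := least_card p_family.

Lemma p_family_ex : p_family !=set0.
Proof.
have [U [UU oU]] := ultraFilterLemma frechet_properfilter_nat.
have Uinf A : U A -> infinite_set A.
  move=> UA finA; have UnA : U (~` A).
    by apply: oU; rewrite /frechet_filter /= setCK.
  by have [n []] := filter_ex (filterI UA UnA).
exists U; split=> // [N NU /finite_fsetP[X eN]|[A [/infiniteP Ainf AU]]].
  apply: Uinf; rewrite eN; apply: (@filter_bigI _ _ X id) => B BX.
  by apply: NU; rewrite eN.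
have /pcard_leP[f] := Ainf.
have finj : injective f by move=> m n; apply: inj; rewrite inE.
have rinf (g : nat -> nat) : injective g -> infinite_set (range (f \o g)).
  move=> ginj; apply/infiniteP; rewrite (card_le_eqr (inj_card_eq _)) //.
  by move=> m n _ _ /= /finj/ginj.
have fA g : range (f \o g) `<=` A by move=> _ [n _ <-]; exact: funS.
have Sdouble_inj : injective (S \o double) by move=> m n [/double_inj].
have [/AU|/AU] := in_ultra_setVsetC (range (f \o double)) UU.
  apply: sub_infinite_set (rinf _ Sdouble_inj) => x /[dup] /fA Ax [n _ <-].
  split; first by apply: funS.
  by move=> [m _ /finj/(congr1 odd)]; rewrite /= !odd_double.
apply: sub_infinite_set (rinf _ double_inj) => x /[dup] /fA Ax xr.
by split=> // /(_ xr).
Qed.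

Lemma pseudo_intersection_numberP :
  has_least_card p_family pseudo_intersection_number.
Proof. exact/least_cardP/p_family_ex. Qed.

(** The sets [I k] are automatically nonempty since the weights sum to [1]. *)
Definition convex_block_subsequence (R : realType) (V : lmodType R)
    (x y : nat -> V) : Prop :=
  exists (I : nat -> {fset nat}) (a : nat -> R),
    [/\ forall k m n, m \in I k -> n \in I k.+1 -> (m < n)%N,
        forall n, 0 <= a n,
        forall k, \sum_(n <- I k) a n = 1
      & forall k, y k = \sum_(n <- I k) a n *: x n].

(** The topological dual of [X], as a set of functions [X -> R]. *)
Definition dual (R : realType) (X : completeNormedModType R) :
    set (X -> R^o) :=
  [set f | linear f /\ continuous f].
Arguments dual {R} X.

(** [X] with its weak topology, the initial topology of the family of all the
    elements of the dual. *)
Definition weak_space (R : realType) (X : completeNormedModType R) :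
    topologicalType :=
  sup_topology (fun f : dual X =>
    Topological.class (initial_topology (val f : X -> R^o))).

Definition weakly_compact (R : realType) (X : completeNormedModType R) :
    set (set X) :=
  [set K | compact (K : set (weak_space X))].
Arguments weakly_compact {R} X.

Definition strongly_generates (R : realType) (X : completeNormedModType R)
    (G : set (set X)) : Prop :=
  G `<=` weakly_compact X /\
  forall (L : set X) (e : R), weakly_compact X L -> 0 < e ->
    exists2 K, G K &
      L `<=` [set x + e *: b | x in K & b in closed_ball (0 : X) 1].
Arguments strongly_generates {R} X G.

Definition SG (R : realType) (X : completeNormedModType R) : set (set X) :=
  least_card (strongly_generates X).
Arguments SG {R} X.

Lemma SGP (R : realType) (X : completeNormedModType R) :
  has_least_card (strongly_generates X) (SG X).
Proof.
apply: least_cardP; exists (weakly_compact X); split=> // L e KL e0.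
exists L => // x Lx; exists x => //; exists 0.
  exact: closed_ballxx.
by rewrite scaler0 addr0.
Qed.

(** The w*-topology and the Mackey topology on the dual are the traces of the
    topology of pointwise convergence and of the topology of uniform convergence
    on weakly compact sets, both living on all functions [X -> R]; hence limits
    are required to be in the dual. *)
Definition weak_star_cvg (R : realType) (X : completeNormedModType R)
    (x : nat -> X -> R^o) (f : X -> R^o) : Prop :=
  [/\ forall n, dual X (x n), dual X f & {ptws, x @ \oo --> f}].

Definition mackey_cvg (R : realType) (X : completeNormedModType R)
    (x : nat -> X -> R^o) (f : X -> R^o) : Prop :=
  [/\ forall n, dual X (x n), dual X f
    & {family weakly_compact X, x @ \oo --> f}].

Definition property_K (R : realType) (X : completeNormedModType R) : Prop :=
  forall x : nat -> X -> R^o, (exists f, weak_star_cvg x f) ->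
    exists2 y : nat -> X -> R^o, convex_block_subsequence x y &
      exists g, mackey_cvg y g.

(* Main.v *)
(** Passing to x_n - f, let (d_n) be a w*-null sequence in the dual, bounded by
    Banach-Steinhaus.  For a weakly compact K, averages of far-out d_n are
    uniformly small on K.  This is Mazur's theorem in C(K), but it is obtained
    here without representing measures, by an argument in the style of Simons'
    inequality.

    The averages of the d_n over nonempty lists of indices form a countable set.
    For each member G of a strongly generating family of cardinality SG(X) < p,
    consider those pairs (m, s) for which s lies beyond m and the average over s
    is at most 1/(m+1) on G.  By the previous step, applied to finite unions of
    members of the family, these sets have the strong finite intersection
    property, and a pseudo-intersection yields blocks that converge uniformly on
    every G, hence, by strong generation and boundedness, on every weakly
    compact set. *)

From HB Require Import structures.
Require Import Defs.
From mathcomp Require Import all_boot all_order all_algebra finmap.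
From mathcomp Require Import all_classical all_reals all_analysis.
From mathcomp Require Import ring lra.

Set Implicit Arguments.
Unset Strict Implicit.
Unset Printing Implicit Defensive.

Import Order.TTheory GRing.Theory Num.Theory.
Import numFieldNormedType.Exports.

Local Open Scope classical_set_scope.
Local Open Scope ring_scope.

(** * Recursive choice and infinite sets of naturals *)

(** Dependent choice with memory: iterating [rcons] builds the history itself, so the requirement on
    a new term may refer to all earlier ones. *)
Lemma history_choice (T : Type) (Q : seq T -> T -> Prop) :
  (forall l, exists t, Q l t) ->
  exists p : nat -> T, forall k, Q (mkseq p k) (p k).
Proof.
move=> /choice[g gP]; pose L := fun k => iter k (fun l => rcons l (g l)) [::].
exists (g \o L) => k; suff -> : mkseq (g \o L) k = L k by exact: gP.
by elim: k => // k IH; rewrite mkseqS IH.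
Qed.

Lemma infinite_set_gt (A : set nat) k : infinite_set A ->
  exists2 c, A c & (k < c)%N.
Proof.
move=> Ainf; apply: contrapT => H; apply: Ainf.
apply: (sub_finite_set _ (finite_II k.+1)) => c Ac /=; rewrite ltnS leqNgt.
by apply/negP => kc; apply: H; exists c.
Qed.

Lemma infinite_range (T : Type) (p : nat -> T) :
  injective p -> infinite_set (range p).
Proof.
move=> pinj; apply/infiniteP; rewrite (card_le_eqr (inj_card_eq _)) //.
by move=> m n _ _ /pinj.
Qed.

(** * Pseudo-intersections below the cardinal p *)

(** For infinite [S], the countably many sets [D n] are absorbed into the family of the [M i]
    without raising its cardinality, so it stays below p. For finite [S], an increasing sequence
    with its k-th term in [D k] and in all [M i] is built directly. *)
Lemma pseudo_intersection_lt_p (T : Type) (S : set T) (M : T -> set nat)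
    (D : nat -> set nat) :
  card_lt S pseudo_intersection_number ->
  (forall m n, (m <= n)%N -> D n `<=` D m) ->
  (forall (F : set T) n, F `<=` S -> finite_set F ->
    infinite_set (\bigcap_(i in F) M i `&` D n)) ->
  exists A, [/\ infinite_set A, forall i, S i -> finite_set (A `\` M i)
    & forall n, finite_set (A `\` D n)].
Proof.
move=> [_ nle] Ddec MD; have [Sfin|Sinf] := pselect (finite_set S).
  have [p pP] : exists p : nat -> nat, forall k,
      (forall x, x \in mkseq p k -> (x < p k)%N) /\
      (\bigcap_(i in S) M i `&` D (size (mkseq p k))) (p k).
    apply: (@history_choice _ (fun l t => (forall x, x \in l -> (x < t)%N) /\
      (\bigcap_(i in S) M i `&` D (size l)) t)) => l.
    (* [sumn l] serves as a bound for all entries of [l]. *)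
    have [] := infinite_set_gt (sumn l) (MD S (size l) (@subset_refl _ S) Sfin).
    move=> c cP lc.
    exists c; split=> // x xl; apply: leq_ltn_trans lc.
    by rewrite sumnE (big_rem x xl) leq_addr.
  have pmono i k : (i < k)%N -> (p i < p k)%N.
    by move=> ik; apply: (pP k).1; apply/mapP; exists i; rewrite ?mem_iota.
  exists (range p); split.
  - apply: infinite_range => i k pik; have [/pmono|/pmono|//] := ltngtP i k;
    by rewrite pik ltnn.
  - move=> i Si; rewrite (_ : _ `\` _ = set0) // -subset0.
    by move=> _ [[k _ <-]]; apply; apply: (pP k).2.1.
  - move=> n; apply: (sub_finite_set _ (finite_image p (finite_II n))).
    move=> _ [[k _ <-] nD]; exists k => //=; rewrite ltnNge; apply/negP => nk.
    by apply: nD; apply: Ddec nk _ _; have := (pP k).2.2; rewrite size_mkseq.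
have /pcard_surjP[g gS] := (infiniteP S).1 Sinf.
(* indexing the sets D n by S through the surjection g avoids computing the
   cardinality of S + nat *)
pose M' := [set M i `&` D (g i) | i in S].
have [[A [Ainf AM']]|npi] := pselect (has_pseudo_intersection M').
  have AM i : S i -> finite_set (A `\` (M i `&` D (g i))).
    by move=> Si; apply: AM'; exists i.
  exists A; split=> // [i Si|n].
    by apply: sub_finite_set (AM i Si); apply: setDS; exact: subIsetl.
  have [i Si <-] := gS n I.
  by apply: sub_finite_set (AM i Si); apply: setDS; exact: subIsetr.
have sfip : strong_fip M'.
  move=> N NM' Nfin; have [i0 Si0] := infinite_setN0 Sinf.
  have /choice[h hP] B : exists i, N B -> S i /\ M i `&` D (g i) = B.
    by have [/NM'[i Si <-]|nNB] := pselect (N B); [exists i|exists i0].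
  have [n gn] : exists n, forall B, N B -> (g (h B) <= n)%N.
    have /finite_seqP[s sE] := finite_image (g \o h) Nfin.
    exists (sumn s) => B NB; have : [set (g \o h) i | i in N] (g (h B)) by exists B.
    by rewrite sE /= sumnE => gs; rewrite (big_rem _ gs) leq_addr.
  have hNS : [set h B | B in N] `<=` S by move=> _ [B NB <-]; have [] := hP B NB.
  apply: sub_infinite_set (MD _ n hNS (finite_image h Nfin)) => c [cM cD] B NB.
  have [_ <-] := hP B NB; split; first by apply: cM; exists B.
  exact: Ddec (gn B NB) _ cD.
exfalso; apply: nle; apply: (@card_le_trans _ _ _ M'); last exact: card_image_le.
apply: pseudo_intersection_numberP.2; split=> //.
move=> _ [i Si <-]; have := MD [set i] (g i) _ (finite_set1 i).
by rewrite bigcap_set1; apply=> _ ->.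
Qed.

(** * Averages over lists of indices *)

Section Average.
Variables (R : realType) (V : lmodType R) (d : nat -> V).

(** Lists may repeat indices: over nonempty lists the averages are exactly the rational convex
    combinations, a countable set closed under midpoints. *)
Definition avg (s : seq nat) : V := (size s)%:R^-1 *: \sum_(n <- s) d n.

(** Repeating [s] as often as [t] has entries, and conversely, gives both lists equal weight in the
    concatenation. *)
Lemma avg_midpoint (s t : seq nat) : s != [::] -> t != [::] ->
  exists u, [/\ u != [::], forall P, all P s -> all P t -> all P u
    & avg u = 2^-1 *: (avg s + avg t)].
Proof.
move=> s0 t0; have sz0 (r : seq nat) : r != [::] -> (size r)%:R != 0 :> R.
  by rewrite pnatr_eq0 size_eq0.
have sum_rep (n : nat) (r : seq nat) :
    \sum_(i <- flatten (nseq n r)) d i = n%:R *: \sum_(i <- r) d i.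
  rewrite scaler_nat; elim: n => [|n IH] /=; first by rewrite big_nil.
  by rewrite big_cat IH mulrS.
have size_rep (n : nat) (r : seq nat) : size (flatten (nseq n r)) = (n * size r)%N.
  by rewrite size_flatten /shape map_nseq sumn_nseq mulnC.
exists (flatten (nseq (size t) s) ++ flatten (nseq (size s) t)); split.
- by rewrite -size_eq0 size_cat !size_rep addn_eq0 !muln_eq0 !size_eq0 negb_and
    negb_or t0 s0.
- move=> P Ps Pt; have all_rep n r : all P r -> all P (flatten (nseq n r)).
    by move=> Pr; elim: n => //= n IH; rewrite all_cat Pr.
  by rewrite all_cat !all_rep.
rewrite /avg size_cat !size_rep big_cat /= !sum_rep mulnC addnn -mul2n.
rewrite !scalerDr !scalerA !natrM.
by congr (_ *: _ + _ *: _); field; rewrite ?sz0.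
Qed.

End Average.

Lemma avgE (R : realType) (T : Type) (d : nat -> T -> R^o) (s : seq nat) (x : T) :
  avg d s x = avg (d^~ x) s.
Proof. by rewrite /avg /= fctE fct_sumE. Qed.

Lemma avg_norm_le (R : realType) (d : nat -> R^o) (s : seq nat) (B : R) :
  0 <= B -> (forall n, n \in s -> `|d n| <= B) -> `|avg d s| <= B.
Proof.
move=> B0 dB; rewrite /avg normrZ normfV normr_nat.
have [->|s0] := eqVneq s [::]; first by rewrite big_nil normr0 mulr0.
rewrite ler_pdivrMl ?ltr0n ?lt0n ?size_eq0//.
apply: le_trans (ler_norm_sum _ _ _) _; rewrite mulrC big_seq.
apply: le_trans (ler_sum _ dB) _; rewrite -big_seq.
by rewrite big_const_seq count_predT iter_addr addr0 mulr_natr.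
Qed.

(** * Series with weights 2^-(i+1) *)

(** The weights from index [n] on sum to 2^-n. The global bound [B0] gives convergence, while the
    tail estimate uses a bound on the tail only, which may be much smaller. *)
Lemma half_series (R : realType) (a : nat -> R) (B0 : R) :
  (forall i, `|a i| <= B0) ->
  exists2 l, (fun n => \sum_(i < n) 2^-1 ^+ i.+1 * a i) @ \oo --> l
    & forall n (B : R), (forall i, (n <= i)%N -> `|a i| <= B) ->
      `|l - \sum_(i < n) 2^-1 ^+ i.+1 * a i| <= 2^-1 ^+ n * B.
Proof.
move=> aB0; pose u n : R := \sum_(i < n) 2^-1 ^+ i.+1 * a i.
(* The exact sum of the weights between [n] and [n + j], rather than 2^-n, lets the induction on [j]
   go through. *)
have udiff n B j : (forall i, (n <= i)%N -> `|a i| <= B) ->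
    `|u (n + j)%N - u n| <= (2^-1 ^+ n - 2^-1 ^+ (n + j)) * B.
  move=> aB; elim: j => [|j IH]; first by rewrite addn0 !subrr mul0r normr0.
  have -> : u (n + j.+1)%N - u n =
      (u (n + j)%N - u n) + 2^-1 ^+ (n + j).+1 * a (n + j)%N.
    by rewrite addnS /u big_ord_recr /= addrAC.
  apply: le_trans (ler_normD _ _) _.
  have h0 : 0 <= 2^-1 ^+ (n + j).+1 :> R by rewrite exprn_ge0.
  rewrite normrM (ger0_norm h0).
  have := ler_wpM2l h0 (aB _ (leq_addr j n)).
  by rewrite addnS exprS in IH *; nra.
have B00 : 0 <= B0 by exact: le_trans (normr_ge0 _) (aB0 0%N).
have pow0 : (fun n => 2^-1 ^+ n : R) @ \oo --> 0.
  by apply: cvg_expr; rewrite ger0_norm// invf_lt1// ltr1n.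
have udiff' n B m : (forall i, (n <= i)%N -> `|a i| <= B) -> (n <= m)%N ->
    `|u m - u n| <= 2^-1 ^+ n * B.
  move=> aB /subnKC <-; apply: le_trans (udiff _ _ _ aB) _.
  apply: ler_wpM2r; first exact: le_trans (normr_ge0 _) (aB _ (leqnn n)).
  by rewrite gerBl exprn_ge0.
have ucvg : cvgn u.
  rewrite [u](_ : _ = series (fun i => 2^-1 ^+ i.+1 * a i)); last first.
    by apply/funext => n; rewrite /series /= big_mkord.
  apply: normed_cvg.
  apply: (@series_le_cvg _ _ (geometric (B0 / 2) 2^-1)) => [n||n|].
  - exact: normr_ge0.
  - by move=> n; rewrite /= mulr_ge0 ?divr_ge0 ?exprn_ge0.
  - rewrite /= normrM ger0_norm ?exprn_ge0// exprS.
    have h0 : 0 <= 2^-1 ^+ n :> R by rewrite exprn_ge0.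
    by have := ler_wpM2l h0 (aB0 n); lra.
  - by apply: is_cvg_geometric_series; rewrite ger0_norm// invf_lt1// ltr1n.
exists (limn u); first exact: ucvg.
move=> n B aB.
have : (fun m => `|u m - u n|) @ \oo --> `|limn u - u n|.
  by apply: cvg_norm; apply: cvgB => //; exact: cvg_cst.
move=> /cvg_lim <- //; apply: limr_le; last first.
  by near=> m; apply: udiff' => //; near: m; exact: nbhs_infty_ge.
by apply: is_cvg_norm; apply: is_cvgB => //; exact: is_cvg_cst.
Unshelve. all: by end_near. Qed.

(** * The dual space and weakly compact sets *)

Section Dual.
Variables (R : realType) (X : completeNormedModType R).
Implicit Types (f g h : X -> R^o) (d : nat -> X -> R^o).

Let pack_linear f (lf : linear f) : {linear X -> R^o} :=
  HB.pack f (GRing.isLinear.Build _ _ _ _ _ lf).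

Lemma dual_boundP f :
  dual X f <-> linear f /\ exists C, forall x, `|f x| <= C * `|x|.
Proof.
split=> -[lf].
  move=> cf; split=> //.
  have /(linear_boundedP (pack_linear lf)) :
      bounded_near (pack_linear lf) (nbhs (0 : X)).
    exact/linear_bounded_continuous.
  by move=> /pinfty_ex_gt0[C _]; exists C.
move=> [C fC]; split=> //; apply: (@bounded_linear_continuous _ _ _ (pack_linear lf)).
apply/linear_boundedP; exists C; split; first exact: num_real.
move=> r /ltW Cr x; apply: le_trans (fC x) _; exact: ler_wpM2r.
Qed.

Lemma dual_lin (a b : R) f g : dual X f -> dual X g ->
  dual X (a *: f + b *: g).
Proof.
move=> /dual_boundP[lf [C fC]] /dual_boundP[lg [D gD]]; apply/dual_boundP; split.
  move=> k u v; rewrite !fctE lf lg /=.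
  by rewrite !scalerDr !scalerA (mulrC a) (mulrC b) addrACA.
exists (`|a| * C + `|b| * D) => x; rewrite !fctE /=.
apply: le_trans (ler_normD _ _) _; rewrite !normrZ mulrDl -!mulrA.
by apply: lerD; apply: ler_wpM2l.
Qed.

Lemma dual0 : dual X (0 : X -> R^o).
Proof.
apply/dual_boundP; split; last by exists 0 => x; rewrite mul0r normr0.
by move=> k u v; change (0 = k *: 0 + 0 :> R^o); rewrite scaler0 addr0.
Qed.

Lemma dualZ (a : R) f : dual X f -> dual X (a *: f).
Proof. by move=> /(dual_lin a 0) /(_ dual0); rewrite scaler0 addr0. Qed.

Lemma dualD f g : dual X f -> dual X g -> dual X (f + g).
Proof. by move=> df /(dual_lin 1 1 df); rewrite !scale1r. Qed.

Lemma dual_sum (I : Type) (r : seq I) (F : I -> X -> R^o) :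
  (forall i, dual X (F i)) -> dual X (\sum_(i <- r) F i).
Proof.
move=> dF; elim/big_ind : _ => //; first exact: dual0.
by move=> ? ?; exact: dualD.
Qed.

Lemma dual_avg d s : (forall n, dual X (d n)) -> dual X (avg d s).
Proof. by move=> dd; apply/dualZ/dual_sum. Qed.

(** Banach-Steinhaus: convergence gives pointwise bounds, and homogeneity extends the uniform bound
    from the unit ball. *)
Lemma dual_equibounded d : (forall n, dual X (d n)) ->
  (forall x, cvgn (d^~ x)) ->
  exists2 C, 0 < C & forall n x, `|d n x| <= C * `|x|.
Proof.
move=> dd dcvg; have : uniform_bounded (range d).
  apply: (@Banach_Steinhauss R X R^o (range d) _ _).
    move=> f [n _ <-]; have [ln [C dC]] := (dual_boundP _).1 (dd n); split=> // r.
    exists (`|C| * r) => x xr; apply: le_trans (dC x) _.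
    apply: le_trans (ler_wpM2r (normr_ge0 x) (ler_norm C)) _.
    exact: ler_wpM2l.
  move=> x; have /pinfty_ex_gt0[M _ HM] := cvg_seq_bounded (dcvg x).
  by exists M => _ [n _ <-]; exact: HM.
move=> /(_ 1)[M dM]; exists (`|M| + 1) => [|n x]; first by rewrite ltr_pwDr.
have [->|x0] := eqVneq x 0.
  by rewrite [d n 0](linear0 (pack_linear (dd n).1)) !normr0 mulr0.
have nx : 0 < `|x| by rewrite normr_gt0.
have : `|d n (`|x|^-1 *: x)| <= M.
  by apply: dM; [exists n|rewrite normrZ normfV normr_id mulVf ?gt_eqF].
rewrite [d n _](linearZ_LR (pack_linear (dd n).1)) /= normrZ normfV normr_id.
rewrite ler_pdivrMl// mulrC => /le_trans; apply; rewrite ler_pM2r//.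
by have := ler_norm M; lra.
Qed.

Lemma weak_continuous f : dual X f -> continuous (f : weak_space X -> R).
Proof.
move=> df x.
have /cvg_sup/(_ (exist _ f (mem_set df))) xf :
    nbhs (x : weak_space X) --> (x : weak_space X) by exact: cvg_id.
apply: (cvg_trans _ (@initial_continuous _ _ f x)).
exact: cvg_app.
Qed.

Lemma weakly_compact_max (K : set X) f : weakly_compact X K -> K !=set0 ->
  dual X f -> exists2 x, K x & forall y, K y -> `|f y| <= `|f x|.
Proof.
move=> cK K0 df; have [] := @compact_EVT_max (weak_space X) R (fun x => `|f x|) K K0 cK.
  apply: continuous_subspaceT => x.
  by apply: (cvg_comp _ _ (weak_continuous df (x:=x))); exact: norm_continuous.
by move=> x; rewrite inE => Kx fx; exists x => // y Ky; apply: fx; rewrite inE.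
Qed.

(** The series is summed pointwise: linearity passes to the limit, and the tail estimate at [n = 0]
    gives continuity. *)
Lemma dual_half_series d (C : R) :
  (forall n, dual X (d n)) -> (forall n x, `|d n x| <= C * `|x|) ->
  exists2 phi, dual X phi
    & forall x n (B : R), (forall i, (n <= i)%N -> `|d i x| <= B) ->
      `|phi x - (\sum_(i < n) 2^-1 ^+ i.+1 *: d i) x| <= 2^-1 ^+ n * B.
Proof.
move=> dd dC.
have /choice[phi phiP] x : exists l,
    (fun n => \sum_(i < n) 2^-1 ^+ i.+1 * d i x) @ \oo --> l
    /\ forall n (B : R), (forall i, (n <= i)%N -> `|d i x| <= B) ->
      `|l - \sum_(i < n) 2^-1 ^+ i.+1 * d i x| <= 2^-1 ^+ n * B.
  by have [l] := half_series (dC^~ x); exists l.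
exists phi => [|x n B dB]; last first.
  by have [_ /(_ n B dB)] := phiP x; rewrite fct_sumE.
apply/dual_boundP; split.
  move=> k u v.
  have lim_kuv : (fun n => k * \sum_(i < n) 2^-1 ^+ i.+1 * d i u +
      \sum_(i < n) 2^-1 ^+ i.+1 * d i v) @ \oo --> k * phi u + phi v.
    by apply: cvgD (phiP v).1; apply: cvgMr; exact: (phiP u).1.
  apply: (cvg_unique _ (phiP (k *: u + v)).1) => //.
  apply: cvg_trans lim_kuv; apply: near_eq_cvg; near=> n.
  rewrite mulr_sumr -big_split; apply: eq_bigr => i _ /=.
  by rewrite (dd i).1 mulrDr mulrCA.
exists C => x; have := (phiP x).2 0%N (C * `|x|) (fun i _ => dC i x).
by rewrite big_ord0 subr0 expr0 mul1r.
Unshelve. all: by end_near. Qed.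

End Dual.

(** * Uniformly small averages on a weakly compact set *)

Section UniformlySmallAverages.
Variables (R : realType) (X : completeNormedModType R).
Variables (d : nat -> X -> R^o) (C : R) (K : set X).
Hypotheses (dd : forall n, dual X (d n))
  (dC : forall n x, `|d n x| <= C * `|x|)
  (d0 : forall x, d^~ x @ \oo --> (0 : R^o))
  (cK : weakly_compact X K).

Let d_small (e : R) x : 0 < e ->
  exists N, forall n, (N <= n)%N -> `|d n x| <= e.
Proof.
move=> e0; have /cvgr0Pnorm_le/(_ e e0)[N _ dN] := d0 x.
by exists N => n Nn; apply: dN.
Qed.

Lemma weakly_compact_bounded_tail : exists N (B : R), forall n x, (N <= n)%N ->
  K x -> `|d n x| <= B.
Proof.
apply: contrapT => unbounded.
(* Gliding hump: indices n_k and points x_k are chosen so that the functional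
   sum_i 2^-(i+1) d_(n_i) exceeds k at x_k. *)
have big N (B : R) : exists n x, [/\ (N <= n)%N, K x & B < `|d n x|].
  apply: contrapT => H; apply: unbounded; exists N, B => n x Nn Kx.
  by rewrite leNgt; apply/negP => Bd; apply: H; exists n, x.
have K0 : K !=set0 by have [n [x [_ Kx _]]] := big 0%N 0; exists x.
have /choice[U UP] n : exists U : R, forall x, K x -> `|d n x| <= U.
  by have [x _ xP] := weakly_compact_max cK K0 (dd n); exists `|d n x|.
(* [W l] bounds on [K] the contribution of the terms already chosen; in [Q], later terms are at most
   1 at earlier points, and the new term outweighs the earlier ones at its own point. *)
pose W (l : seq (nat * X)) :=
  \sum_(i < size l) 2^-1 ^+ i.+1 * U (nth (0%N, 0) l i).1.
pose Q (l : seq (nat * X)) (p : nat * X) := [/\ K p.2,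
  forall q, q \in l -> `|d p.1 q.2| <= 1
  & W l + (size l).+1%:R < 2^-1 ^+ (size l).+1 * `|d p.1 p.2|].
have [l|p pP] := @history_choice _ Q.
  have [N Nl] : exists N, forall n q, (N <= n)%N -> q \in l -> `|d n q.2| <= 1.
    elim: l => [|[m y] l [N NP]]; first by exists 0%N.
    have [N' N'P] := d_small y ltr01; exists (maxn N N') => n q.
    rewrite geq_max inE => /andP[Nn N'n] /orP[/eqP->|]; first exact: N'P.
    exact: NP.
  have [n [x [Nn Kx dnx]]] := big N (2 ^+ (size l).+1 * (W l + (size l).+1%:R)).
  exists (n, x); split=> // [q ql|]; first exact: Nl.
  by rewrite exprVn ltr_pdivlMl// exprn_gt0.
have [phi dphi phiP] := dual_half_series (fun i => dd (p i).1) (fun i => dC (p i).1).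
have [x _ phix] := weakly_compact_max cK K0 dphi.
(* On [K] the values of [phi] stay below k. At the k-th point, however, the k-th term exceeds [W] +
   k + 1, the earlier ones give at most [W] and the later ones at most 1. *)
pose k := (Num.truncn `|phi x|).+1.
have [Kk _] := pP k; have := phix _ Kk.
have := phiP (p k).2 k.+1 1; rewrite size_mkseq => tail.
have {}tail :
    `|phi (p k).2 - (\sum_(i < k.+1) 2^-1 ^+ i.+1 *: d (p i).1) (p k).2| <= 1.
  apply: le_trans (tail _) _.
    move=> i ki; have [_ + _] := pP i; apply.
    by apply/mapP; exists k; rewrite ?mem_iota.
  by rewrite mulr1 exprn_ile1// invf_le1// ler1n.
have head : `|(\sum_(i < k) 2^-1 ^+ i.+1 *: d (p i).1) (p k).2| <= W (mkseq p k).
  rewrite fct_sumE /W size_mkseq; apply: le_trans (ler_norm_sum _ _ _) _.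
  apply: ler_sum => i _; rewrite fctE normrZ ger0_norm ?exprn_ge0//.
  by apply: ler_wpM2l; rewrite ?exprn_ge0// nth_mkseq// UP.
have kx : `|phi x| < k%:R by rewrite truncnS_gt.
have [_ _] := pP k; rewrite size_mkseq.
move: tail; rewrite big_ord_recr /= fctE.
set A := (\sum_(i < k) _) _ in head *; set z := (2^-1 ^+ k.+1 *: _) _.
rewrite (_ : 2^-1 ^+ k.+1 * `|_| = `|z|); last first.
  by rewrite /z fctE normrZ ger0_norm ?exprn_ge0.
move=> tail; have -> : z = phi (p k).2 - A - (phi (p k).2 - (A + z)).
  by rewrite opprB [RHS]addrC subrKA addrAC subrr add0r.
have := ler_normB (phi (p k).2 - A) (phi (p k).2 - (A + z)).
have := ler_normB (phi (p k).2) A.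
by rewrite -natr1; lra.
Qed.

Lemma bounded_small_avg (N : nat) (B e : R) : 0 < e ->
  (forall n x, (N <= n)%N -> K x -> `|d n x| <= B) ->
  exists s, [/\ s != [::], all (leq N) s & forall x, K x -> `|avg d s x| <= e].
Proof.
move=> e0 dB; apply: contrapT => H.
have big s : s != [::] -> all (leq N) s -> exists2 x, K x & e < `|avg d s x|.
  move=> s0 Ns; apply: contrapT => H'; apply: H; exists s; split=> // x Kx.
  by rewrite leNgt; apply/negP => ex; apply: H'; exists x.
have K0 : K !=set0.
  by have [//||x Kx _] := big [:: N]; [rewrite /= leqnn|exists x].
have B0 : 0 <= B.
  by case: K0 => x Kx; exact: le_trans (normr_ge0 _) (dB N x (leqnn N) Kx).
have avgB s : all (leq N) s -> forall x, K x -> `|avg d s x| <= B.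
  move=> /allP Ns x Kx; rewrite avgE; apply: avg_norm_le => // n /Ns Nn.
  exact: dB.
(* [S h] is the maximum of |h| on [K], attained by weak compactness; outside the dual its value is
   arbitrary. *)
have /choice[S SP] h : exists r : R, dual X h ->
    (exists2 x, K x & r = `|h x|) /\ forall y, K y -> `|h y| <= r.
  have [dh|ndh] := pselect (dual X h); last by exists 0.
  have [x Kx hx] := weakly_compact_max cK K0 dh.
  by exists `|h x| => _; split=> //; exists x.
have S_le h (r : R) : dual X h -> (forall x, K x -> `|h x| <= r) -> S h <= r.
  by move=> dh hr; have [[x Kx ->] _] := SP _ dh; exact: hr.
have S_ub h x : dual X h -> K x -> `|h x| <= S h.
  by move=> dh Kx; have [_] := SP _ dh; exact.
pose good k s := s != [::] /\ all (leq (N + k)) s.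
have good_le k m s : (k <= m)%N -> good m s -> good k s.
  move=> km [s0 /allP ms]; split=> //; apply/allP => n /ms; apply: leq_trans.
  by rewrite leq_add2l.
have goodN k s : good k s -> all (leq N) s.
  by move=> /(good_le 0%N k _ (leq0n k))[_]; rewrite addn0.
pose half k : R := 2^-1 ^+ k.
pose F (l : seq (seq nat)) : X -> R^o :=
  \sum_(i < size l) half i.+1 *: avg d (nth [::] l i).
pose V l s := S (F l + half (size l) *: avg d s).
have dualF l : dual X (F l) by apply: dual_sum => i; exact/dualZ/dual_avg.
have dualV l s : dual X (F l + half (size l) *: avg d s).
  by apply: dualD => //; exact/dualZ/dual_avg.
have V_ge0 l s : 0 <= V l s.
  by rewrite /V; have [[x _ ->] _] := SP _ (dualV l s); exact: normr_ge0.
(* A slack of order 4^-k adds up to only O(2^-k) in [decay]; a slack of order 2^-k would accumulate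
   to k 2^-k. *)
pose delta k := e / 4 * half (k + k).
have half0 k : 0 < half k by rewrite exprn_gt0.
(* p k almost minimises S (G k + 2^-k g) among the averages g of lists beyond
   N + k, where G k = sum_(i < k) 2^-(i+1) g_i is the part already chosen.  The
   limit phi of G k is itself a limit of such candidates ([mix]), whence
   [near_opt], and by convexity S (G k) is at most about (1 - 2^-k) S phi.  So
   at a point x where |phi| attains S phi the tail of the series has size about
   2^-k S phi; but it is o(2^-k), since d_n x tends to 0. *)
have [l|p pP] := @history_choice _ (fun l s => good (size l) s /\
    forall t, good (size l) t -> V l s <= V l t + delta (size l)).
  pose A := [set V l t | t in good (size l)].
  have infA : has_inf A.
    split; last by exists 0 => _ [t _ <-].
    exists (V l [:: N + size l]%N); exists [:: N + size l]%N => //.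
    by split=> //=; rewrite leqnn.
  have delta0 : 0 < delta (size l) by rewrite mulr_gt0// divr_gt0.
  have [_ [s gs <-] sA] := inf_adherent delta0 infA.
  exists s; split=> // t gt; apply: le_trans (ltW sA) _; rewrite lerD2r.
  by apply: ge_inf; [exact: infA.2|exists t].
pose g k := avg d (p k).
have pgood k : good k (p k) by have [] := pP k; rewrite size_mkseq.
pose G k := F (mkseq p k).
have GS k : G k.+1 = G k + half k.+1 *: g k.
  rewrite /G /F !size_mkseq big_ord_recr /= nth_mkseq//; congr (_ + _).
  by apply: eq_bigr => i _; rewrite !nth_mkseq// ltnS ltnW.
have halfS k : half k = half k.+1 + half k.+1 by rewrite /half exprS; field.
(* Since 2^-k is twice 2^-(k+1), one midpoint merges [g k] with the average that the induction
   hypothesis supplies at [k.+1]. *)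
have mix j : forall k, exists2 t, good k t &
    G k + half k *: avg d t = G (k + j)%N + half (k + j)%N *: g (k + j)%N.
  elim: j => [|j IH] k; first by exists (p k); rewrite ?addn0.
  have [t gt tE] := IH k.+1.
  have [u [u0 uall uE]] := avg_midpoint d (pgood k).1 gt.1.
  exists u; last first.
    by rewrite addnS -addSn -tE GS uE scalerA -[half k * _]exprSr scalerDr addrA.
  split=> //; apply: uall; first by have [] := pgood k.
  by have [] := good_le k k.+1 t (leqnSn k) gt.
have GE n : G n = \sum_(i < n) half i.+1 *: g i.
  by elim: n => [|n IH]; rewrite ?GS ?IH ?big_ord_recr// /G /F /= !big_ord0.
have gC i x : `|g i x| <= C * `|x|.
  rewrite /g avgE; apply: avg_norm_le => //.
  exact: le_trans (normr_ge0 _) (dC 0%N x).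
have [phi dphi phiP] := dual_half_series (fun i => dual_avg (p i) dd) gC.
have gB i x : K x -> `|g i x| <= B.
  by move=> Kx; apply: avgB => //; exact: goodN (pgood i).
have half_small k (eta : R) : 0 < eta -> exists j, half (k + j)%N * (B + B) <= eta.
  move=> eta0; have : (fun n => half n * (B + B)) @ \oo --> (0 : R).
    rewrite -[X in _ --> X](mul0r (B + B)); apply: cvgMl.
    by apply: cvg_expr; rewrite ger0_norm// invf_lt1// ltr1n.
  move=> /cvgr0Pnorm_le/(_ _ eta0)[j _ jP]; exists j.
  by apply: le_trans (ler_norm _) (jP _ _); rewrite /= leq_addl.
have dualG k : dual X (G k) by exact: dualF.
have dualGg k : dual X (G k + half k *: g k).
  by apply: dualD => //; exact/dualZ/dual_avg.
have near_opt k : S (G k + half k *: g k) <= S phi + delta k.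
  (* On [K], cutting the series at n = k + j and adding 2^-n [g n] cost at most 2^-n [B] each,
     whence [B + B]. *)
  apply/ler_addgt0Pr => eta eta0; have [j jeta] := half_small k eta eta0.
  have [t gt tE] := mix j k; have [_] := pP k.
  rewrite size_mkseq => /(_ t gt); rewrite /V size_mkseq -/(G k) tE -/(g k).
  move=> /le_trans; apply; rewrite addrAC lerD2r.
  apply: S_le => // x Kx; set n := (k + j)%N in jeta *.
  have := phiP x n B (fun i _ => gB i x Kx); rewrite -GE -/(half n) => phiG.
  have phix := S_ub _ _ dphi Kx.
  have hg := ler_wpM2l (ltW (half0 n)) (gB n x Kx).
  rewrite fctE; apply: le_trans (ler_normD _ _) _.
  rewrite [X in _ + X]normrZ (gtr0_norm (half0 n)).
  by have := ler_normB (phi x) (phi x - G n x); rewrite subKr; lra.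
(* [G k.+1] is the midpoint of [G k] and [G k] + 2^-k [g k]; the stated error solves the resulting
   recursion with slack [delta] exactly. *)
have decay k : S (G k) <= (1 - half k) * S phi + half k * (1 - half k) * (e / 2).
  elim: k => [|k IH].
    rewrite /half expr0 subrr !mul0r mulr0 mul0r addr0; apply: S_le => // x _.
    by rewrite GE big_ord0 normr0.
  have step : S (G k.+1) <= 2^-1 * S (G k) + 2^-1 * S (G k + half k *: g k).
    apply: S_le => // x Kx.
    have -> : G k.+1 x = 2^-1 * G k x + 2^-1 * (G k + half k *: g k) x.
      by rewrite GS !fctE /half exprS /GRing.scale /=; field.
    apply: le_trans (ler_normD _ _) _; rewrite !normrM ger0_norm//.
    by apply: lerD; apply: ler_wpM2l => //; exact: S_ub.
  have := near_opt k; rewrite /delta /half exprD exprS -/(half k) in step *.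
  by move: IH; lra.
(* At k = 0 the candidate is [g 0] itself, which exceeds [e] somewhere on [K], and [delta 0] is
   e/4. *)
have Sphi : e < S phi + e / 4.
  have [x Kx ex] := big (p 0%N) (pgood 0%N).1 (goodN _ _ (pgood 0%N)).
  have := near_opt 0%N; have := S_ub _ _ (dualGg 0%N) Kx.
  by rewrite GE big_ord0 add0r /half expr0 scale1r /delta /half expr0 -/(g 0%N); lra.
have [[x Kx Sx] _] := SP _ dphi.
(* The tail at [x] is then at most 2^-k e/8. With [decay], dividing by 2^-k, this gives S phi <= e/8
   + e/2, against S phi > 3e/4. *)
have [k dk] := d_small x (e := e / 8) ltac:(lra).
have gk i : (k <= i)%N -> `|g i x| <= e / 8.
  move=> ki; rewrite /g avgE; apply: avg_norm_le; first lra.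
  move=> n /(allP (pgood i).2) Nn; apply: dk.
  exact: leq_trans (leq_trans ki (leq_addl _ _)) Nn.
have := S_ub (G k) x (dualG k) Kx; have := decay k.
have := phiP x k _ gk; rewrite -GE -/(half k).
have := ler_normD (phi x - G k x) (G k x); rewrite subrK -Sx.
have : 0 < half k * (S phi - e / 4 * 3) by rewrite mulr_gt0 ?half0//; lra.
have := mulr_gt0 (half0 k) e0.
have := mulr_ge0 (mulr_ge0 (ltW (half0 k)) (ltW (half0 k))) (ltW e0).
by lra.
Qed.

Lemma small_avg (N : nat) (e : R) : 0 < e ->
  exists s, [/\ s != [::], all (leq N) s & forall x, K x -> `|avg d s x| <= e].
Proof.
move=> e0; have [N' [B dB]] := weakly_compact_bounded_tail.
have dB' n x : (maxn N N' <= n)%N -> K x -> `|d n x| <= B.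
  by rewrite geq_max => /andP[_]; exact: dB.
have [s [s0 /allP Ns sK]] := bounded_small_avg e0 dB'.
exists s; split=> //; apply/allP => n /Ns.
by rewrite /= geq_max => /andP[].
Qed.

End UniformlySmallAverages.

(** * Convex blocks and Mackey convergence *)

Lemma weakly_compact_bigcup (R : realType) (X : completeNormedModType R)
    (F : set (set X)) :
  finite_set F -> F `<=` weakly_compact X -> weakly_compact X (\bigcup_(A in F) A).
Proof.
move=> /finite_seqP[s ->] Fs; rewrite bigcup_seq big_seq.
by apply: (@bigsetU_compact (weak_space X)) => A As; exact: Fs.
Qed.

Lemma finite_setD_near (A M : set nat) (c : nat -> nat) :
  injective c -> (forall k, A (c k)) -> finite_set (A `\` M) ->
  \forall k \near \oo, M (c k).
Proof.
move=> cinj Ac AMfin.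
have /finite_seqP[s sE] : finite_set (c @^-1` (A `\` M)).
  by apply: finite_preimage => // ? ? _ _; exact: cinj.
exists (sumn s).+1 => // k /= sk; apply: contrapT => nM.
have : (c @^-1` (A `\` M)) k by [].
rewrite sE /= => ks; move: sk; rewrite ltnNge sumnE (big_rem k ks) /=.
by rewrite leq_addr.
Qed.

(** Grouping equal entries turns multiplicities into the weights of a convex block. *)
Lemma avg_fset (R : realType) (V : lmodType R) (x : nat -> V)
    (s : seq nat) : avg x s =
  \sum_(n <- [fset n in s]%fset) ((size s)%:R^-1 * (count_mem n s)%:R) *: x n.
Proof.
have ps : perm_eq [fset n in s]%fset (undup s).
  apply: uniq_perm; [exact: fset_uniq|exact: undup_uniq|move=> n].
  by rewrite !inE mem_undup.
rewrite (perm_big _ ps) /avg -big_undup_iterop_count scaler_sumr; apply: eq_bigr => n _.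
by rewrite -scalerA scaler_nat.
Qed.

Section AverageBlocks.
Variables (R : realType) (V : lmodType R) (x : nat -> V).

Lemma avgB_cst (v : V) (s : seq nat) : s != [::] ->
  avg (fun n => x n - v) s = avg x s - v.
Proof.
move=> s0; rewrite /avg sumrB scalerBr; congr (_ - _).
rewrite big_const_seq count_predT iter_addr addr0 -[v *+ _]scaler_nat.
by rewrite scalerA mulVf ?scale1r// pnatr_eq0 size_eq0.
Qed.

(** One weight sequence must serve all blocks: the lists being separated, an index occurs in at most
    one of them, which fixes its weight; indices in none get 0. Averaging the constant 1 shows that
    the weights sum to 1. *)
Lemma avg_convex_block (s : nat -> seq nat) :
  (forall k, s k != [::]) ->
  (forall i k m n, (i < k)%N -> m \in s i -> n \in s k -> (m < n)%N) ->
  convex_block_subsequence x (fun k => avg x (s k)).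
Proof.
move=> s0 ltss.
have /choice[a aP] n : exists r : R, 0 <= r /\
    forall k, n \in s k -> r = (size (s k))%:R^-1 * (count_mem n (s k))%:R.
  have [[k nk]|nk] := pselect (exists k, n \in s k); last first.
    by exists 0; split=> // k ?; exfalso; apply: nk; exists k.
  exists ((size (s k))%:R^-1 * (count_mem n (s k))%:R); split.
    by rewrite mulr_ge0 ?invr_ge0.
  move=> i ni; have [ik|ki|->//] := ltngtP i k.
    by have := ltss i k n n ik ni nk; rewrite ltnn.
  by have := ltss k i n n ki nk ni; rewrite ltnn.
exists (fun k => [fset n in s k]%fset), a; split.
- by move=> k m n; rewrite !inE; exact: ltss.
- by move=> n; have [] := aP n.
- move=> k; transitivity (avg (fun=> 1 : R^o) (s k)); last first.
    rewrite /avg big_const_seq count_predT iter_addr addr0.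
    by rewrite /GRing.scale /= mulVf// pnatr_eq0 size_eq0.
  rewrite avg_fset !big_seq; apply: eq_bigr => n; rewrite !inE => nk.
  by have [_ /(_ k nk) ->] := aP n; rewrite /GRing.scale /= mulr1.
- move=> k; rewrite avg_fset !big_seq; apply: eq_bigr => n; rewrite !inE => nk.
  by have [_ /(_ k nk) ->] := aP n.
Qed.

End AverageBlocks.

Theorem theorem2p7 (R : realType) (X : completeNormedModType R) :
  card_lt (SG X) pseudo_intersection_number -> property_K X.
Proof.
move=> SGp x [f [dualx dualf xf]].
have [[SGwc SGgen] _] := SGP X.
pose d n := x n - f.
have duald n : dual X (d n).
  by have := dual_lin 1 (-1) (dualx n) dualf; rewrite scale1r scaleN1r.
have d0 y : d^~ y @ \oo --> (0 : R^o).
  rewrite -(subrr (f y)); apply: cvgB; last exact: cvg_cst.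
  exact: (pointwise_cvgP _ _).1 xf y.
have [C C0 dC] : exists2 C : R, 0 < C & forall n y, `|d n y| <= C * `|y|.
  by apply: dual_equibounded => // y; apply/cvg_ex; exists 0; exact: d0.
pose code : nat * seq nat -> nat := choice.pickle.
have code_inj : injective code by exact: (pcan_inj (@choice.pickleK _)).
(* [D n] carries the conditions that do not involve [G]; almost inclusion in every [D n] forces m to
   infinity, hence both far-out indices and precision tending to 0. *)
pose D n := [set c | exists (m : nat) (s : seq nat),
  [/\ c = code (m, s), (n <= m)%N, s != [::] & all (leq m) s]].
pose M G := [set c | exists (m : nat) (s : seq nat), c = code (m, s) /\
  forall y, G y -> `|avg d s y| <= m.+1%:R^-1].
have [||A [Ainf AM AD]] := @pseudo_intersection_lt_p _ _ M D SGp.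
- move=> m n mn c [k [s [-> nk s0 ks]]]; exists k, s; split=> //.
  exact: leq_trans mn nk.
- move=> F n FSG Ffin.
  have cF := weakly_compact_bigcup Ffin (subset_trans FSG SGwc).
  have /choice[s sP] m : exists s, [/\ s != [::], all (leq m) s
      & forall y, (\bigcup_(A in F) A) y -> `|avg d s y| <= m.+1%:R^-1].
    by apply: (small_avg duald dC d0 cF); rewrite invr_gt0.
  pose c j := code ((n + j)%N, s (n + j)%N).
  apply: (@sub_infinite_set _ (range c)); last first.
    by apply: infinite_range => i j /code_inj[/addnI].
  move=> _ [j _ <-]; have [s0 js sF] := sP (n + j)%N; split.
    move=> G FG; exists (n + j)%N, (s (n + j)%N); split=> // y Gy.
    by apply: sF; exists G.
  by exists (n + j)%N, (s (n + j)%N); split=> //; exact: leq_addr.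
have AD' n : exists2 c, A c & D n c.
  apply: contrapT => H; apply: Ainf; apply: sub_finite_set (AD n) => c Ac.
  by split=> // Dc; apply: H; exists c.
(* The bound [size l <= q.1] turns the precision 1/(m+1) into at most 1/(k+1). Strictly increasing
   first components make [p] injective, so that almost inclusion in [M G] becomes eventual
   membership; the last condition separates the blocks. *)
have [l|p pP] := @history_choice _ (fun (l : seq (nat * seq nat)) q =>
    [/\ A (code q), q.2 != [::], all (leq q.1) q.2, (size l <= q.1)%N
      & forall r, r \in l -> (r.1 < q.1)%N /\ forall i, i \in r.2 -> (i < q.1)%N]).
  have [n nl] : exists n, forall r, r \in l ->
      (r.1 < n)%N /\ forall i, i \in r.2 -> (i < n)%N.
    elim: l => [|q l [n nl]]; first by exists 0%N.
    exists (n + (q.1 + sumn q.2).+1)%N => r; rewrite inE => /orP[/eqP->|/nl[rn ri]].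
      split=> [|i iq]; rewrite addnS ltnS.
        exact: leq_trans (leq_addr _ _) (leq_addl _ _).
      rewrite sumnE (big_rem i iq) /=.
      by apply: leq_trans (leq_addl n _); rewrite addnCA leq_addr.
    by split=> [|i /ri] ; [move: rn|]; move=> /leq_trans; apply; exact: leq_addr.
  have [c Ac [m [s [cE nm s0 ms]]]] := AD' (n + size l)%N.
  exists (m, s); split=> //=; first by rewrite -cE.
    exact: leq_trans (leq_addl _ _) nm.
  have {}nm : (n <= m)%N := leq_trans (leq_addr _ _) nm.
  by move=> r /nl[rn ri]; split=> [|i /ri]; [move: rn|]; move=> /leq_trans; apply.
have ltp i k : (i < k)%N ->
    ((p i).1 < (p k).1)%N /\ forall n, n \in (p i).2 -> (n < (p k).1)%N.
  move=> ik; have [_ _ _ _] := pP k; apply.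
  by apply/mapP; exists i; rewrite ?mem_iota.
have cinj : injective (code \o p).
  move=> i k /code_inj pik.
  by have [/ltp|/ltp|//] := ltngtP i k; rewrite pik ltnn => -[].
pose y k := avg x (p k).2.
have s0 k : (p k).2 != [::] by have [] := pP k.
have Ap k : A (code (p k)) by have [] := pP k.
exists y.
  apply: avg_convex_block => // i k m n ik mi nk.
  have [_ _ /allP/(_ n nk) pn _ _] := pP k.
  by apply: leq_trans pn; apply: (ltp i k ik).2.
have yE k : y k - f = avg d (p k).2 by rewrite avgB_cst.
exists f; split=> // [k|]; first exact: dual_avg.
apply/fam_cvgP => L cL P /uniform_nbhs[E [entE EP]].
move: entE; rewrite -entourage_ballE => -[e /= e0 eE].
(* A point of [L] is g + (e/(3C)) b with g in [G] and b in the unit ball, where the averages are at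
   most [C]; each part thus contributes at most e/3. *)
have e'0 : 0 < e / (3 * C) by rewrite divr_gt0// mulr_gt0.
have [G SGG LG] := SGgen L _ cL e'0.
have cM := finite_setD_near cinj (Ap) (AM G SGG).
have small_inv : \forall k \near \oo, (k.+1%:R^-1 : R) < e / 3.
  have e30 : 0 < e / 3 by rewrite divr_gt0.
  exact: (near_infty_natSinv_lt (PosNum e30)).
near=> k; apply: EP => z Lz; apply: eE => /=.
have [g Gg [b Bb <-]] := LG z Lz.
rewrite /ball /= distrC.
have -> : y k (g + (e / (3 * C)) *: b) - f (g + (e / (3 * C)) *: b) =
    avg d (p k).2 g + e / (3 * C) * avg d (p k).2 b.
  have -> : forall z, y k z - f z = avg d (p k).2 z by move=> z'; rewrite -yE.
  by rewrite addrC (dual_avg _ duald).1 addrC.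
have avgb : `|avg d (p k).2 b| <= C.
  have nb : `|b| <= 1.
    by move: Bb; rewrite closed_ballE// /closed_ball_ /= sub0r normrN.
  rewrite avgE; apply: avg_norm_le => [|n _]; first exact: ltW.
  by apply: le_trans (dC n b) _; rewrite ler_piMr// ltW.
have avgg : `|avg d (p k).2 g| < e / 3.
  have [m [s [/code_inj pE]]] : M G (code (p k)) by near: k.
  rewrite pE /= => /(_ g Gg) /le_lt_trans; apply.
  apply: (@le_lt_trans _ _ k.+1%:R^-1); last by near: k.
  rewrite lef_pV2 ?posrE// ler_nat ltnS.
  by have [_ _ _ + _] := pP k; rewrite size_mkseq pE.
apply: le_lt_trans (ler_normD _ _) _.
rewrite [X in _ + X < _]normrM (gtr0_norm e'0).
have := ler_wpM2l (ltW e'0) avgb.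
have -> : e / (3 * C) * C = e / 3 by field; rewrite ?gt_eqF.
by lra.
Unshelve. all: by end_near. Qed.
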